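(* (i) Let $x:T^n=\mathbb{R}^n/\Lambda_n\to\mathbb{S}^{2N-1}$ be a homogeneous isometric immersion, where $T^n$ carries the metric $\frac{4\pi^2}{n}(du_1^2+\dots+du_n^2)$ and $N$ is half the dimension of the eigenspace of $T^n$ for the eigenvalue $n$ (equivalently $2N$ is the number of vectors of length $1$ in $\Lambda_n^*$). Let $Q$ be the Gram matrix of $\Lambda_n^*$ with respect to a chosen basis and let $Y\subset\mathbb{Z}^n$ be the set of coordinate vectors in this basis of the vectors of $\Lambda_n^*$ of length $1$ (one chosen from each pair $\pm\xi$). If $x$ is minimal and linearly full, then $\frac1nQ^{-1}$ lies in the relative interior of $C_Y$ and is a critical point of the determinant function restricted to $C_Y$. (ii) Conversely, let $X\subset\mathbb{Z}^n$ be a finite set with $C_X\cap\Sigma_+\ne\varnothing$. If $P$ lies in the relative interior of $C_X$ and is a critical point of the determinant function restricted to $C_X$, then the flat torus $\mathbb{R}^n/\Lambda_n$, where $\Lambda_n$ is a lattice with Gram matrix $nP$, equipped with the metric $\frac{4\pi^2}{n}(du_1^2+\dots+du_n^2)$, admits an isometric minimal immersion in some $\mathbb{S}^{2N-1}$.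
   Context: $S(n)$ is the space of real symmetric $n\times n$ matrices and $\Sigma_+\subset S(n)$ the set of positive definite matrices. Vectors in $\mathbb{Z}^n$ are row vectors. For $X\subset\mathbb{Z}^n$, $C_X\subset S(n)$ is the convex hull of $\{A^tA:A\in X\}$; relative interior is taken in the affine hull of $C_X$, and a critical point of $\det$ on $C_X$ at a relative interior point means that the derivative of $\det$ vanishes in all directions tangent to the affine hull. The dual lattice is $\Lambda_n^*=\{\xi:\langle\xi,v\rangle\in\mathbb{Z}\ \forall v\in\Lambda_n\}$. An immersion $x$ of $\mathbb{R}^n/\Lambda_n$ into a sphere is called homogeneous here if, up to an orthogonal transformation, it has the form $x(u)=(c_1e^{2\pi i\langle\xi_1,u\rangle},\dots,c_Ne^{2\pi i\langle\xi_N,u\rangle})$ with $\xi_j\in\Lambda_n^*$ and $c_j\ge0$. Linearly full in $\mathbb{S}^{2N-1}$ means the image is not contained in a proper linear subspace of $\mathbb{R}^{2N}$. *)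

(* Defs.v *)
From HB Require Import structures.
From mathcomp Require Import all_boot all_order all_algebra.
From mathcomp Require Import all_classical all_reals all_analysis.

Set Implicit Arguments.
Unset Strict Implicit.
Unset Printing Implicit Defensive.

Import Order.TTheory GRing.Theory Num.Theory.
Import numFieldNormedType.Exports.

Local Open Scope classical_set_scope.
Local Open Scope ring_scope.

(* The library norm on 'rV[R]_n is the sup norm; lengths and angles use the
   Euclidean structure below. *)
Definition dotv (R : realType) (n : nat) (u v : 'rV[R]_n) : R :=
  (u *m v^T) 0 0.

Definition enorm (R : realType) (n : nat) (u : 'rV[R]_n) : R :=
  Num.sqrt (dotv u u).

Definition zrow (R : realType) (n : nat) (a : 'rV[int]_n) : 'rV[R]_n :=
  map_mx intr a.

(* The rows of B form a Z-basis of the full-rank lattice L. *)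
Definition lattice_basis (R : realType) (n : nat) (B : 'M[R]_n)
    (L : set 'rV[R]_n) : Prop :=
  B \in unitmx /\ L = [set zrow R a *m B | a in [set: 'rV[int]_n]].

Definition is_lattice (R : realType) (n : nat) (L : set 'rV[R]_n) : Prop :=
  exists B : 'M[R]_n, lattice_basis B L.

Definition gram (R : realType) (n : nat) (B : 'M[R]_n) : 'M[R]_n := B *m B^T.

Definition dual_lattice (R : realType) (n : nat) (L : set 'rV[R]_n) :
    set 'rV[R]_n :=
  [set xi | forall v, L v -> dotv xi v \is a Num.int].

(* For the lattice with basis D, Y consists of the D-coordinates of exactly one
   vector of each pair +-xi of lattice vectors of length 1. *)
Definition unit_coordinates (R : realType) (n : nat) (D : 'M[R]_n)
    (Y : set 'rV[int]_n) : Prop :=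
  (forall a, Y a -> enorm (zrow R a *m D) = 1) /\
  (forall a, enorm (zrow R a *m D) = 1 ->
     (Y a \/ Y (- a)) /\ ~ (Y a /\ Y (- a))).

Definition posdef (R : realType) (n : nat) : set 'M[R]_n :=
  [set M | M^T = M /\ forall v : 'rV[R]_n, v != 0 -> 0 < (v *m M *m v^T) 0 0].
Arguments posdef : clear implicits.

Definition convex_hull (R : realType) (V : lmodType R) (S : set V) : set V :=
  [set p | exists (k : nat) (t : 'I_k -> R) (s : 'I_k -> V),
     [/\ forall i, 0 <= t i, \sum_i t i = 1, forall i, S (s i)
       & p = \sum_i t i *: s i]].

Definition affine_hull (R : realType) (V : lmodType R) (S : set V) : set V :=
  [set p | exists (k : nat) (t : 'I_k -> R) (s : 'I_k -> V),
     [/\ \sum_i t i = 1, forall i, S (s i) & p = \sum_i t i *: s i]].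

Definition relative_interior (R : realType) (V : normedModType R)
    (C : set V) : set V :=
  [set p | C p /\ exists2 e : R, 0 < e & ball p e `&` affine_hull C `<=` C].

Definition critical_point (R : realType) (V : normedModType R)
    (f : V -> R) (C : set V) (p : V) : Prop :=
  forall q q', affine_hull C q -> affine_hull C q' -> is_derive p (q - q') f 0.

Definition C_ (R : realType) (n : nat) (X : set 'rV[int]_n) : set 'M[R]_n :=
  convex_hull [set (zrow R a)^T *m zrow R a | a in X].
Arguments C_ R {n} X.

Definition partial (R : realType) (n : nat) (W : normedModType R) (i : 'I_n)
    (f : 'rV[R]_n -> W) : 'rV[R]_n -> W :=
  'D_(delta_mx 0 i) f.

Fixpoint Ck (R : realType) (n : nat) (W : normedModType R) (k : nat)
    (f : 'rV[R]_n -> W) : Prop :=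
  if k is k'.+1 then
    (forall u, differentiable f u) /\ forall i : 'I_n, Ck k' (partial i f)
  else continuous f.

Definition smooth (R : realType) (n : nat) (W : normedModType R)
    (f : 'rV[R]_n -> W) : Prop :=
  forall k, Ck k f.

(* Maps on the torus R^n/L are represented by their L-periodic lifts to R^n;
   the coordinates u_1, ..., u_n of R^n are local coordinates of the torus. *)
Definition periodic (R : realType) (n : nat) (T : Type) (L : set 'rV[R]_n)
    (f : 'rV[R]_n -> T) : Prop :=
  forall u v, L v -> f (u + v) = f u.

Definition torus_metric (R : realType) (n : nat) : 'M[R]_n :=
  (4 * pi ^+ 2 / n%:R)%:M.

(* The Laplace-Beltrami operator of a metric with constant coefficients g. *)
Definition laplacian (R : realType) (n : nat) (g : 'M[R]_n)
    (f : 'rV[R]_n -> R) (u : 'rV[R]_n) : R :=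
  \sum_i \sum_j invmx g i j * partial i (partial j f) u.

(* Eigenvalues are those of the nonnegative operator - laplacian g. *)
Definition torus_eigenspace (R : realType) (n : nat) (L : set 'rV[R]_n)
    (g : 'M[R]_n) (lambda : R) : set ('rV[R]_n -> R) :=
  [set f | [/\ smooth f, periodic L f
             & forall u, - laplacian g f u = lambda * f u]].

Definition has_dim (R : realType) (T : Type) (E : set (T -> R)) (d : nat) :
    Prop :=
  exists b : 'I_d -> T -> R,
    [/\ forall i, E (b i),
        forall t : 'I_d -> R,
          (forall u, \sum_i t i * b i u = 0) -> forall i, t i = 0
      & forall f, E f ->
          exists t : 'I_d -> R, forall u, f u = \sum_i t i * b i u].

Definition first_fundamental_form (R : realType) (n m : nat)
    (x : 'rV[R]_n -> 'rV[R]_m) (u : 'rV[R]_n) : 'M[R]_n :=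
  \matrix_(i, j) dotv (partial i x u) (partial j x u).

Record isometric_immersion (R : realType) (n m : nat) (L : set 'rV[R]_n)
    (g : 'M[R]_n) (x : 'rV[R]_n -> 'rV[R]_m) : Prop := {
  immersion_smooth : smooth x;
  immersion_periodic : periodic L x;
  immersion_sphere : forall u, enorm (x u) = 1;
  immersion_rank : forall u, row_free (jacobian x u);
  immersion_isometric : forall u, first_fundamental_form x u = g }.

(* Vectors normal to the immersed manifold inside the unit sphere at x u. *)
Definition sphere_normal (R : realType) (n m : nat)
    (x : 'rV[R]_n -> 'rV[R]_m) (u : 'rV[R]_n) : set 'rV[R]_m :=
  [set nu | dotv (x u) nu = 0 /\ forall i, dotv (partial i x u) nu = 0].

Definition second_fundamental_form (R : realType) (n m : nat)
    (x : 'rV[R]_n -> 'rV[R]_m) (u : 'rV[R]_n) (nu : 'rV[R]_m) : 'M[R]_n :=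
  \matrix_(i, j) dotv (partial i (partial j x) u) nu.

Definition mean_curvature (R : realType) (n m : nat)
    (x : 'rV[R]_n -> 'rV[R]_m) (u : 'rV[R]_n) (nu : 'rV[R]_m) : R :=
  n%:R^-1 * \tr (invmx (first_fundamental_form x u) *m
                 second_fundamental_form x u nu).

(* Vanishing of the mean curvature vector of the immersion into the sphere:
   mean_curvature x u nu is its inner product with the normal vector nu. *)
Definition minimal (R : realType) (n m : nat)
    (x : 'rV[R]_n -> 'rV[R]_m) : Prop :=
  forall u nu, sphere_normal x u nu -> mean_curvature x u nu = 0.

(* C^N is identified with R^(N + N), real parts first. *)
Definition exp_map (R : realType) (n N : nat) (xi : 'I_N -> 'rV[R]_n)
    (c : 'I_N -> R) (u : 'rV[R]_n) : 'rV[R]_(N + N) :=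
  row_mx (\row_j (c j * cos (2 * pi * dotv (xi j) u)))
         (\row_j (c j * sin (2 * pi * dotv (xi j) u))).

Definition homogeneous (R : realType) (n N : nat) (L : set 'rV[R]_n)
    (x : 'rV[R]_n -> 'rV[R]_(N + N)) : Prop :=
  exists (xi : 'I_N -> 'rV[R]_n) (c : 'I_N -> R) (O : 'M[R]_(N + N)),
    [/\ forall j, dual_lattice L (xi j), forall j, 0 <= c j,
        O *m O^T = 1%:M & forall u, x u = exp_map xi c u *m O].

Definition linearly_full (R : realType) (n m : nat)
    (x : 'rV[R]_n -> 'rV[R]_m) : Prop :=
  forall W : {vspace 'rV[R]_m}, (forall u, x u \in W) -> W = fullv.

(* Main.v *)
(* A homogeneous map [x u = (c_j e^(2 pi i <xi_j, u>))_j] induces the torus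
   metric iff [sum_j c_j^2 xi_j^T xi_j = I / n], and its Laplacian is
   [(- n |xi_j|^2 x_j)_j]; hence, when it is isometric into the sphere, it is
   minimal iff [|xi_j| = 1] whenever [c_j <> 0].  In coordinates
   [xi_j = a_j D], with [Q = D D^T], the first condition says that
   [P = Q^-1 / n] is the convex combination [sum_j c_j^2 a_j^T a_j], and, since
   the derivative of [det] at [P] is [H |-> det P tr (P^-1 H)], the condition
   [n |xi_j|^2 = tr (P^-1 a_j^T a_j) = n] says that [P] is critical on the
   hull of the [a_j^T a_j].
   In (i), fullness makes all [c_j] nonzero and the waves of frequency [xi_j]
   linearly independent; the dimension count then makes them span the
   eigenspace, so that the [xi_j] exhaust the unit vectors of the dual lattice
   up to sign, and [P] has positive weight on every generator of the hull. *)

Require Import Defs.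
From HB Require Import structures.
From mathcomp Require Import all_boot all_order all_algebra.
From mathcomp Require Import all_classical all_reals all_analysis.
From mathcomp Require Import ring lra.

Import Order.TTheory GRing.Theory Num.Theory.
Import numFieldNormedType.Exports.

Set Implicit Arguments.
Unset Strict Implicit.
Unset Printing Implicit Defensive.

Local Open Scope classical_set_scope.
Local Open Scope ring_scope.

(** * Convex and affine hulls *)

Lemma exists_pos_lower_bound (R : realType) (k : nat) (t : 'I_k -> R) :
  (forall i, 0 < t i) -> exists2 m : R, 0 < m & forall i, m <= t i.
Proof.
elim: k t => [|k IHk] t t_gt0; first by exists 1 => // -[].
have [m m_gt0 mP] := IHk (fun i => t (lift ord0 i)) (fun i => t_gt0 _).
exists (Num.min (t ord0) m); first by rewrite lt_min t_gt0.
move=> i; case: (unliftP ord0 i) => [j|] ->; rewrite ge_min ?lexx ?mP ?orbT//.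
Qed.

Lemma convex_hull_sub (R : realType) (V : lmodType R) (S : set V) :
  S `<=` convex_hull S.
Proof.
move=> p Sp; exists 1%N, (fun=> 1), (fun=> p); split => //.
  by rewrite big_ord1.
by rewrite big_ord1 scale1r.
Qed.

Lemma affine_hull_sub (R : realType) (V : lmodType R) (S : set V) :
  S `<=` affine_hull S.
Proof.
move=> p Sp; exists 1%N, (fun=> 1), (fun=> p); split => //.
  by rewrite big_ord1.
by rewrite big_ord1 scale1r.
Qed.

Lemma affine_hull_line (R : realType) (V : lmodType R) (S : set V) (p q : V)
    (r : R) :
  S p -> S q -> affine_hull S (p + r *: (p - q)).
Proof.
move=> Sp Sq; exists 2%N, (fun i => if i == ord0 then 1 + r else - r),
  (fun i => if i == ord0 then p else q); split.
- by rewrite big_ord_recl big_ord1 /= addrK.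
- by move=> i; case: ifP.
- by rewrite big_ord_recl big_ord1 /= scalerDl scale1r scalerBr scaleNr addrA.
Qed.

Lemma convex_hull_sub_affine (R : realType) (V : lmodType R) (S : set V) :
  convex_hull S `<=` affine_hull S.
Proof. by move=> p [k [t [s [_ t1 Ss ->]]]]; exists k, t, s. Qed.

(** Weights that fall on the same generator are added, so one weight per index of the family is
    enough. *)
Lemma affine_hull_range (R : realType) (V : lmodType R) (k : nat)
    (s : 'I_k -> V) (p : V) :
  affine_hull (range s) p ->
  exists2 t : 'I_k -> R, \sum_i t i = 1 & p = \sum_i t i *: s i.
Proof.
case=> m [t [r [t1 rs ->]]].
have [h hP] : {h : 'I_m -> 'I_k & forall i, r i = s (h i)}.
  apply: (@choice _ _ (fun i j => r i = s j)) => i.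
  by have [j _ <-] := rs i; exists j.
exists (fun j => \sum_(i | h i == j) t i).
  by rewrite -t1 (partition_big h xpredT).
under [RHS]eq_bigr => j _ do rewrite scaler_suml.
rewrite (partition_big h xpredT)//=; apply: eq_bigr => j _.
by apply: eq_bigr => i /eqP <-; rewrite hP.
Qed.

(** An affine combination of convex combinations multiplies out; tangent directions of the hull can
    thus be tested on its generators. *)
Lemma affine_hull_convex_hull (R : realType) (V : lmodType R) (k : nat)
    (s : 'I_k -> V) (p : V) :
  affine_hull (convex_hull (range s)) p -> affine_hull (range s) p.
Proof.
case=> m [t [r [t1 rs ->]]].
have [w wP] : {w : 'I_m -> 'I_k -> R & forall i,
    \sum_j w i j = 1 /\ r i = \sum_j w i j *: s j}.
  apply: (@choice _ _ (fun i w => \sum_j w j = 1 /\ r i = \sum_j w j *: s j)).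
  move=> i; have [w w1 ->] := affine_hull_range (convex_hull_sub_affine (rs i)).
  by exists w.
exists k, (fun j => \sum_i t i * w i j), s; split => //.
  rewrite exchange_big/= -t1; apply: eq_bigr => i _.
  by rewrite -mulr_sumr (wP i).1 mulr1.
under [RHS]eq_bigr => j _ do rewrite scaler_suml.
rewrite exchange_big/=; apply: eq_bigr => i _.
rewrite {1}(wP i).2 scaler_sumr; apply: eq_bigr => j _; by rewrite scalerA.
Qed.

(* The barycentric coordinates of a nearby point of the affine hull are chosen
   through a fixed linear map, the partial inverse of the matrix of the
   generators, so they stay close to the positive coordinates [t]. *)
Lemma relative_interior_pos (R : realType) (m n k : nat)
    (s : 'I_k -> 'M[R]_(m, n)) (t : 'I_k -> R) :
  (forall i, 0 < t i) -> \sum_i t i = 1 ->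
  relative_interior (convex_hull (range s)) (\sum_i t i *: s i).
Proof.
move=> t_gt0 t1; split.
  by exists k, t, s; split => // i; rewrite ltW.
have [e e_gt0 e_le] := exists_pos_lower_bound t_gt0.
(* The column of ones records the sum of the weights, which turns affine relations between the
   generators into linear ones. *)
pose S : 'M[R]_(k, m * n + 1) := \matrix_i row_mx (mxvec (s i)) 1.
have SE (w : 'rV_k) :
    w *m S = row_mx (mxvec (\sum_i w 0 i *: s i)) (\sum_i w 0 i)%:M.
  apply/rowP => j; rewrite mxE.
  have [i ->|i ->] := split_ordP j.
    rewrite row_mxEl linear_sum summxE; apply: eq_bigr => l _.
    by rewrite linearZ/= [in RHS]mxE mxE row_mxEl.
  rewrite row_mxEr mxE ord1 eqxx mulr1n; apply: eq_bigr => l _.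
  by rewrite mxE row_mxEr mxE eqxx mulr1.
pose K := \sum_i \sum_j `|pinvmx S i j|.
have K_ge0 : 0 <= K by do 2!apply: sumr_ge0 => ? _.
have K1_gt0 : 0 < K + 1 by lra.
(* [K] bounds the absolute column sums of [pinvmx S], so within this radius each weight moves by at
   most [e]. *)
exists (e / (K + 1)); first by rewrite divr_gt0.
move=> q [] qball /affine_hull_convex_hull/affine_hull_range [w w1 qE].
set p := \sum_i t i *: s i in qball *.
pose d : 'rV[R]_(m * n + 1) := row_mx (mxvec (q - p)) 0.
have dS : (d <= S)%MS.
  apply/submxP; exists (\row_i (w i - t i)); rewrite SE; congr row_mx.
    congr mxvec; rewrite qE /p -sumrB; apply: eq_bigr => i _.
    by rewrite mxE scalerBl.
  under eq_bigr => i _ do rewrite mxE.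
  by rewrite sumrB w1 t1 subrr raddf0.
have := mulmxKpV dS; set v := d *m pinvmx S; rewrite SE => /eq_row_mx[].
move=> /(can_inj mxvecK) vE /matrixP/(_ 0 0); rewrite !mxE eqxx mulr1n => v0.
have dle j : `|d 0 j| <= e / (K + 1).
  have [i ->|i ->] := split_ordP j; last first.
    by rewrite row_mxEr mxE normr0 ltW// divr_gt0.
  rewrite row_mxEl; case/mxvec_indexP: i => a b; rewrite mxvecE.
  case: qball => _ /(_ a b); rewrite -ball_normE/= !mxE => /ltW.
  by rewrite distrC.
have vle i : `|v 0 i| <= e.
  rewrite mxE; apply: le_trans (ler_norm_sum _ _ _) _.
  apply: (@le_trans _ _ (e / (K + 1) * K)).
    rewrite mulr_sumr; apply: ler_sum => j _; rewrite normrM.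
    apply: ler_pM => //; rewrite (bigD1 i)//= lerDl; exact: sumr_ge0.
  by rewrite mulrAC ler_pdivrMr// ler_pM2l//; lra.
exists k, (fun i => t i + v 0 i), s; split.
- move=> i; have := vle i; have := e_le i; rewrite ler_norml => ? /andP[]; lra.
- by rewrite big_split/= t1 v0 addr0.
- by move=> i; exists i.
- under eq_bigr => i _ do rewrite scalerDl.
  by rewrite big_split/= vE addrC subrK.
Qed.

(** * Positive definite matrices and the derivative of the determinant *)

(** The second matrix is the Schur complement of the corner entry: its form at [v] is the minimum of
    the form of [P] over the vectors [(a, v)]. *)
Lemma posdef_block (R : realType) (n : nat) (P : 'M[R]_(1 + n)) :
  posdef R _ P -> 0 < P 0 0 /\
  posdef R n (drsubmx P - (P 0 0)^-1 *: ((ursubmx P)^T *m ursubmx P)).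
Proof.
move=> [Psym Ppos].
have ulE : ulsubmx P = (P 0 0)%:M.
  apply/matrixP => i j; rewrite !ord1 !mxE eqxx mulr1n.
  by congr (P _ _); apply/val_inj.
have dlE : dlsubmx P = (ursubmx P)^T by rewrite trmx_ursub Psym.
have drE : (drsubmx P)^T = drsubmx P by rewrite trmx_drsub Psym.
have quad (a : R) (v : 'rV[R]_n) :
    (row_mx a%:M v *m P *m (row_mx a%:M v)^T) 0 0 =
    a ^+ 2 * P 0 0 + 2 * a * (v *m (ursubmx P)^T) 0 0
      + (v *m drsubmx P *m v^T) 0 0.
  rewrite -{1}[P]submxK mul_row_block tr_row_mx mul_row_col ulE dlE.
  have urE : (ursubmx P *m v^T) 0 0 = (v *m (ursubmx P)^T) 0 0.
    by rewrite -[v in RHS]trmxK -trmx_mul [in RHS]mxE.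
  rewrite tr_scalar_mx !mul_mx_scalar !mul_scalar_mx !mulmxDl -!scalemxAl.
  move: urE; set x := v *m _^T; set y := ursubmx P *m _; set z := v *m _ *m _.
  rewrite !mxE => ->; rewrite eqxx mulr1n; ring.
have P00 : 0 < P 0 0.
  have h : row_mx 1%:M (0 : 'rV[R]_n) != 0.
    apply/eqP => /(congr1 (fun w : 'rV[R]_(1 + n) => lsubmx w 0 0)).
    by rewrite row_mxKl !mxE eqxx => /eqP; rewrite oner_eq0.
  by have := Ppos _ h; rewrite quad !mul0mx !mxE; lra.
split=> //; split.
  by rewrite linearB/= linearZ/= trmx_mul trmxK drE.
move=> v v0; pose b := (v *m (ursubmx P)^T) 0 0.
(* The first coordinate is the minimiser in [a] of the quadratic polynomial [quad]. *)
have h : row_mx (- (P 0 0)^-1 * b)%:M v != 0.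
  apply: contra_neq v0 => /(congr1 rsubmx); rewrite row_mxKr => ->.
  by rewrite linear0.
have := Ppos _ h; rewrite quad -/b mulmxBr mulmxBl.
have -> : v *m ((P 0 0)^-1 *: ((ursubmx P)^T *m ursubmx P)) *m v^T
    = ((P 0 0)^-1 * (b * b))%:M.
  rewrite -scalemxAr -scalemxAl mulmxA -[X in _ *: X]mulmxA.
  have -> : ursubmx P *m v^T = (v *m (ursubmx P)^T)^T by rewrite trmx_mul trmxK.
  rewrite [v *m (ursubmx P)^T]mx11_scalar -/b tr_scalar_mx -scalar_mxM.
  by rewrite scale_scalar_mx.
move: (v *m drsubmx P *m v^T) => z; rewrite !mxE eqxx mulr1n.
have -> : (- (P 0 0)^-1 * b) ^+ 2 * P 0 0 + 2 * (- (P 0 0)^-1 * b) * b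
    = - ((P 0 0)^-1 * (b * b)) by field; rewrite gt_eqF.
by rewrite addrC.
Qed.

(** Induction on the size: the root of the corner entry and a factor of the Schur complement are
    assembled into a block lower triangular [B]. *)
Lemma cholesky (R : realType) (n : nat) (P : 'M[R]_n) :
  posdef R n P -> exists2 B : 'M[R]_n, B \in unitmx & gram B = P.
Proof.
elim: n P => [|n IHn].
  by move=> P _; exists 1%:M; rewrite ?unitmx1//; apply/matrixP => -[].
rewrite -[n.+1]/(1 + n)%N => P Ppos.
have [a_gt0 /IHn[B Bu BE]] := posdef_block Ppos.
pose a : R := Num.sqrt (P 0 0).
have a2 : a * a = P 0 0 by rewrite -expr2 sqr_sqrtr ?ltW.
have a0 : a != 0 by rewrite gt_eqF// sqrtr_gt0.
exists (block_mx a%:M 0 (a^-1 *: (ursubmx P)^T) B).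
  by rewrite unitmxE det_lblock det_scalar unitrM -unitmxE Bu andbT unitfE.
have [Psym _] := Ppos.
rewrite /gram tr_block_mx mulmx_block -/(gram B) BE -[RHS]submxK.
rewrite tr_scalar_mx trmx0 linearZ/= trmxK !mul0mx !mulmx0 !addr0.
congr block_mx.
- rewrite -scalar_mxM a2; apply/matrixP => i j.
  by rewrite !ord1 !mxE eqxx mulr1n; congr (P _ _); apply/val_inj.
- by rewrite mul_scalar_mx scalerA mulfV// scale1r.
- by rewrite mul_mx_scalar scalerA mulfV// scale1r trmx_ursub Psym.
- rewrite -scalemxAl -scalemxAr scalerA -invfM a2; by rewrite addrC subrK.
Qed.

(** With [M = - P^-1 H], the determinant of [t H + P] is [det P] times [det (1 - t M)], the reversed
    characteristic polynomial of [M], whose linear coefficient is [- tr M]. *)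
Lemma is_derive_det (R : realType) (n : nat) (P H : 'M[R]_n) :
  (0 < n)%N -> P \in unitmx ->
  is_derive P H (fun M : 'M[R]_n => \det M) (\det P * \tr (invmx P *m H)).
Proof.
move=> n_gt0 Pu; pose M := - (invmx P *m H).
pose p : {poly R} := \det P *: \poly_(i < n.+1) (char_poly M)`_(n - i).
have lead1 : (char_poly M)`_n = 1.
  by have /monicP := char_poly_monic M; rewrite lead_coefE size_char_poly.
have pE t : \det (t *: H + P) = p.[t].
  rewrite /p hornerZ horner_poly.
  have -> : t *: H + P = P *m (1%:M - t *: M).
    by rewrite /M scalerN opprK mulmxDr mulmx1 -scalemxAr mulKVmx// addrC.
  rewrite det_mulmx; congr (_ * _).
  (* The reversal evaluates at [t^-1], so [t = 0] is treated apart; only the leading coefficient 1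
     survives there. *)
  have [->|t0] := eqVneq t 0.
    rewrite scale0r subr0 det1 big_ord_recl subn0 lead1 mul1r expr0.
    by rewrite big1 ?addr0// => i _; rewrite expr0n mulr0.
  have -> : 1%:M - t *: M = t *: (t^-1%:M - M).
    by rewrite scalerBr scale_scalar_mx mulfV.
  rewrite detZ.
  have -> : \det (t^-1%:M - M) = (char_poly M).[t^-1].
    rewrite /char_poly -horner_evalE -det_map_mx; congr (\det _).
    apply/matrixP => i j; rewrite !mxE /= horner_evalE.
    by rewrite hornerD hornerN hornerC hornerMn hornerX.
  rewrite horner_coef size_char_poly mulr_sumr.
  rewrite (reindex_inj rev_ord_inj)/=; apply: eq_bigr => i _.
  rewrite subSS mulrCA; congr (_ * _).
  have le_in : (i <= n)%N by rewrite -ltnS.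
  rewrite exprVn; apply: (mulIf (expf_neq0 (n - i) t0)).
  by rewrite mulfVK ?expf_neq0// -exprD subnKC.
have pE' : (fun h : R => \det (h *: H + P)) = horner p by apply/funext.
have d0 : p^`().[0] = \det P * \tr (invmx P *m H).
  rewrite horner_coef0 coef_deriv mulr1n coefZ coef_poly ltnS n_gt0.
  by rewrite subn1 char_poly_trace// raddfN opprK.
split; first by apply/derivable1P; rewrite pE'; have [] := is_derive_poly p 0.
have [_] := is_derive_poly p 0; rewrite d0 => <-.
rewrite -pE' /derive; set f := (X in lim (X @ _)).
set g := (X in _ = lim (X @ _)).
suff -> : f = g by [].
by apply/funext => h; rewrite /f /g /= addr0 scale0r add0r [_%:A]mulr1.
Qed.

(** * Trigonometric maps *)

Lemma dotvE (R : realType) (n : nat) (u v : 'rV[R]_n) :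
  dotv u v = \sum_i u 0 i * v 0 i.
Proof. by rewrite /dotv mxE; apply: eq_bigr => i _; rewrite mxE. Qed.

Lemma dotvC (R : realType) (n : nat) (u v : 'rV[R]_n) : dotv u v = dotv v u.
Proof. by rewrite !dotvE; apply: eq_bigr => i _; rewrite mulrC. Qed.

Lemma dotvDr (R : realType) (n : nat) (u v w : 'rV[R]_n) :
  dotv u (v + w) = dotv u v + dotv u w.
Proof.
by rewrite !dotvE -big_split; apply: eq_bigr => i _; rewrite mxE mulrDr.
Qed.

Lemma dotvZr (R : realType) (n : nat) (a : R) (u v : 'rV[R]_n) :
  dotv u (a *: v) = a * dotv u v.
Proof.
by rewrite !dotvE mulr_sumr; apply: eq_bigr => i _; rewrite mxE mulrCA.
Qed.

Lemma dotvDl (R : realType) (n : nat) (u v w : 'rV[R]_n) :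
  dotv (u + v) w = dotv u w + dotv v w.
Proof. by rewrite dotvC dotvDr !(dotvC w). Qed.

Lemma dotvZl (R : realType) (n : nat) (a : R) (u v : 'rV[R]_n) :
  dotv (a *: u) v = a * dotv u v.
Proof. by rewrite dotvC dotvZr dotvC. Qed.

Lemma dotv_suml (R : realType) (n : nat) (I : finType) (f : I -> 'rV[R]_n)
    (v : 'rV[R]_n) :
  dotv (\sum_i f i) v = \sum_i dotv (f i) v.
Proof. by rewrite /dotv mulmx_suml summxE. Qed.

Lemma dotv_delta (R : realType) (n : nat) (u : 'rV[R]_n) (i : 'I_n) :
  dotv u (delta_mx 0 i) = u 0 i.
Proof.
rewrite dotvE (bigD1 i)//= mxE !eqxx mulr1 big1 ?addr0// => j /negbTE ji.
by rewrite mxE ji andbF mulr0.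
Qed.

Lemma dotv_ge0 (R : realType) (n : nat) (u : 'rV[R]_n) : 0 <= dotv u u.
Proof. by rewrite dotvE; apply: sumr_ge0 => i _; rewrite -expr2 sqr_ge0. Qed.

Lemma dotv_eq0 (R : realType) (n : nat) (u : 'rV[R]_n) :
  dotv u u = 0 -> u = 0.
Proof.
rewrite dotvE => /eqP; rewrite psumr_eq0; last first.
  by move=> i _; rewrite -expr2 sqr_ge0.
move=> /allP h; apply/rowP => i; rewrite mxE; apply/eqP.
by have := h i (mem_index_enum _); rewrite /= mulf_eq0 orbb.
Qed.

Lemma enorm_eq1 (R : realType) (n : nat) (u : 'rV[R]_n) :
  enorm u = 1 <-> dotv u u = 1.
Proof.
rewrite /enorm; split => [h|->]; last by rewrite sqrtr1.
by rewrite -[LHS]sqr_sqrtr ?dotv_ge0// h expr1n.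
Qed.

Section trigonometric_maps.
Context {R : realType} {n : nat}.

Definition phase (xi u : 'rV[R]_n) : R := 2 * pi * dotv xi u.

Lemma phaseD (xi u v : 'rV[R]_n) : phase xi (u + v) = phase xi u + phase xi v.
Proof. by rewrite /phase dotvDr mulrDr. Qed.

Lemma phaseN (xi u : 'rV[R]_n) : phase xi (- u) = - phase xi u.
Proof. by rewrite /phase -scaleN1r dotvZr mulN1r mulrN. Qed.

Fact phase_is_linear (xi : 'rV[R]_n) :
  linear (phase xi : 'rV[R]_n -> R^o).
Proof. by move=> a u v; rewrite phaseD /phase dotvZr mulrCA. Qed.

HB.instance Definition _ (xi : 'rV[R]_n) :=
  GRing.isLinear.Build R 'rV[R]_n R^o _ (phase xi) (phase_is_linear xi).

Lemma differentiable_phase (xi u : 'rV[R]_n) : differentiable (phase xi) u.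
Proof.
have -> : phase xi = \sum_i (fun v : 'rV[R]_n => v 0 i * (2 * pi * xi 0 i)).
  apply/funext => v; rewrite fct_sumE /phase dotvE mulr_sumr.
  by apply: eq_bigr => i _; ring.
apply: differentiable_sum => i.
apply: differentiableM => //; exact: differentiable_coord.
Qed.

Lemma derive_phase (xi u v : 'rV[R]_n) : 'D_v (phase xi) u = phase xi v.
Proof.
rewrite deriveE; last exact: differentiable_phase.
rewrite (@diff_lin _ _ _ (phase xi))//.
move=> x; exact/differentiable_continuous/differentiable_phase.
Qed.

Lemma is_derive_comp_phase (f : R -> R) (df : R) (xi u v : 'rV[R]_n) :
  is_derive (phase xi u) 1 f df ->
  differentiable (f \o phase xi) u /\
  is_derive u v (f \o phase xi) (df * phase xi v).
Proof.
move=> [fd fdf].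
have fdiff : differentiable f (phase xi u) by exact/derivable1_diffP.
have fpd : differentiable (f \o phase xi) u.
  apply: differentiable_comp; last exact: fdiff.
  exact: differentiable_phase.
split => //; split; first exact: diff_derivable.
rewrite deriveE// diff_comp//=; last exact: differentiable_phase.
rewrite -(deriveE _ (differentiable_phase xi u)).
by rewrite derive_phase diff1E// derive1E fdf mulrC.
Qed.

Context {W : normedModType R} {N : nat}.
Implicit Types (xi : 'I_N -> 'rV[R]_n) (a b : 'I_N -> W).

(** This family is closed under partial derivatives, so smoothness of every order follows by one
    induction. The general [W] serves both scalar eigenfunctions and immersions. *)
Definition trig xi a b (u : 'rV[R]_n) : W :=
  \sum_k (cos (phase (xi k) u) *: a k + sin (phase (xi k) u) *: b k).

Lemma trig_sum xi a b : trig xi a b =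
  \sum_k ((fun u => cos (phase (xi k) u) *: a k) +
          (fun u => sin (phase (xi k) u) *: b k)).
Proof. by apply/funext => u; rewrite fct_sumE. Qed.

Lemma differentiable_trig xi a b u : differentiable (trig xi a b) u.
Proof.
rewrite trig_sum; apply: differentiable_sum => k; apply: differentiableD.
- apply: differentiableZl.
  by have [] := is_derive_comp_phase u (is_derive_cos (phase (xi k) u)).
- apply: differentiableZl.
  by have [] := is_derive_comp_phase u (is_derive_sin (phase (xi k) u)).
Qed.

Lemma partial_trig xi a b (i : 'I_n) :
  partial i (trig xi a b) = trig xi (fun k => (2 * pi * xi k 0 i) *: b k)
                                    (fun k => - ((2 * pi * xi k 0 i) *: a k)).
Proof.
apply/funext => u; rewrite /partial deriveE; last exact: differentiable_trig.
have dl (f : R -> R) (df : R) k (w : W) : is_derive (phase (xi k) u) 1 f df ->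
    differentiable (fun u => f (phase (xi k) u) *: w) u /\
    'D_(delta_mx 0 i) (fun u => f (phase (xi k) u) *: w) u =
      (df * (2 * pi * xi k 0 i)) *: w.
  move=> /(is_derive_comp_phase (delta_mx 0 i))[fd [_ fv]].
  have fwd : differentiable (fun u => f (phase (xi k) u) *: w) u.
    exact: differentiableZl.
  split=> //; rewrite deriveE// diffZl//= -deriveE// fv.
  by rewrite /phase dotv_delta.
rewrite -deriveE; last exact: differentiable_trig.
rewrite trig_sum derive_sum; last first.
  move=> k; apply: diff_derivable; apply: differentiableD.
  - by have [] := dl _ _ k (a k) (is_derive_cos _).
  - by have [] := dl _ _ k (b k) (is_derive_sin _).
apply: eq_bigr => k _.
have [cd cv] := dl _ _ k (a k) (is_derive_cos _).
have [sd sv] := dl _ _ k (b k) (is_derive_sin _).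
rewrite deriveD; [|exact: diff_derivable..].
rewrite cv sv addrC !scalerA scalerN scalerA mulNr scaleNr; congr (_ + _).
Qed.

Lemma smooth_trig xi a b : smooth (trig xi a b).
Proof.
move=> k; elim: k a b => [|k IHk] a b /=.
  move=> u; exact/differentiable_continuous/differentiable_trig.
split; first exact: differentiable_trig.
by move=> i; rewrite partial_trig.
Qed.

Lemma periodic_trig xi a b (L : set 'rV[R]_n) :
  (forall k, dual_lattice L (xi k)) -> Defs.periodic L (trig xi a b).
Proof.
move=> xiL u v Lv; apply: eq_bigr => k _; rewrite phaseD.
have /intrP[z zE] := xiL k v Lv.
have {zE} -> : phase (xi k) v = pi *+ 2 *~ z.
  by rewrite /phase zE -mulrzr mulr2n; ring.
(* The period [2 pi] is iterated [z] times, with separate inductions for the two signs of [z]. *)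
have cosz (f : R -> R) (x : R) :
    (forall x, f (x + pi *+ 2) = f x) -> f (x + pi *+ 2 *~ z) = f x.
  move=> f2pi; case: z => m.
    by rewrite -pmulrn; elim: m => [|m IHm]; rewrite ?addr0// mulrSr addrA f2pi.
  rewrite NegzE mulrNz -pmulrn.
  elim: m.+1 => [|l IHl]; first by rewrite subr0.
  by rewrite mulrSr opprD addrA -IHl -[in RHS](subrK (pi *+ 2) (x - _)) f2pi.
by rewrite (cosz cos) ?(cosz sin)//; [exact: sinD2pi | exact: cosD2pi].
Qed.

End trigonometric_maps.

(** * Homogeneous immersions *)

Section framed_exponential_maps.
Context {R : realType} {n N : nat}.
Variables (xi : 'I_N -> 'rV[R]_n) (O : 'M[R]_(N + N)).
Implicit Types p q : 'I_N -> R.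

(* Each complex coordinate is [(p k + i q k) e^(2 pi i <xi k, u>)]; a derivative
   multiplies it by an imaginary constant, i.e. sends [(p, q)] to
   [(- kappa q, kappa p)]. *)
Definition framed_exp p q (u : 'rV[R]_n) : 'rV[R]_(N + N) :=
  row_mx (\row_k (p k * cos (phase (xi k) u) - q k * sin (phase (xi k) u)))
         (\row_k (q k * cos (phase (xi k) u) + p k * sin (phase (xi k) u)))
  *m O.

(** Differentiation is inherited from [trig], while the framed form is the one suited to inner
    products. *)
Lemma framed_exp_trig p q : framed_exp p q =
  trig xi (fun k => p k *: row (lshift N k) O + q k *: row (rshift N k) O)
          (fun k => p k *: row (rshift N k) O - q k *: row (lshift N k) O).
Proof.
apply/funext => u; rewrite /framed_exp mulmx_sum_row big_split_ord/= /trig.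
rewrite -big_split/=; apply: eq_bigr => k _.
rewrite row_mxEl row_mxEr; apply/rowP => j; rewrite !mxE; ring.
Qed.

Lemma smooth_framed_exp p q : smooth (framed_exp p q).
Proof. by rewrite framed_exp_trig; exact: smooth_trig. Qed.

Lemma differentiable_framed_exp p q u : differentiable (framed_exp p q) u.
Proof. by rewrite framed_exp_trig; exact: differentiable_trig. Qed.

Lemma periodic_framed_exp p q (L : set 'rV[R]_n) :
  (forall k, dual_lattice L (xi k)) -> Defs.periodic L (framed_exp p q).
Proof. by rewrite framed_exp_trig; exact: periodic_trig. Qed.

Lemma partial_framed_exp p q (i : 'I_n) :
  partial i (framed_exp p q) =
  framed_exp (fun k => - (2 * pi * xi k 0 i * q k))
             (fun k => 2 * pi * xi k 0 i * p k).
Proof.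
rewrite !framed_exp_trig partial_trig; congr trig; apply/funext => k.
  by rewrite scalerBr !scalerA scaleNr addrC.
by rewrite scalerDr !scalerA scaleNr opprD addrC.
Qed.

Hypothesis O_orth : O *m O^T = 1%:M.

(** [O] preserves inner products, and in each complex coordinate both vectors are rotated by the
    same phase; hence the value is independent of [u]. *)
Lemma dotv_framed_exp p q p' q' u :
  dotv (framed_exp p q u) (framed_exp p' q' u) =
  \sum_k (p k * p' k + q k * q' k).
Proof.
rewrite /dotv /framed_exp trmx_mul mulmxA -[_ *m O *m _]mulmxA O_orth mulmx1.
rewrite tr_row_mx mul_row_col mxE [X in X + _]mxE [X in _ + X]mxE.
rewrite -big_split/=; apply: eq_bigr => k _; rewrite !mxE.
have := cos2Dsin2 (phase (xi k) u).
set c := cos _; set s := sin _ => cs.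
transitivity ((p k * p' k + q k * q' k) * (c ^+ 2 + s ^+ 2)); first by ring.
by rewrite cs mulr1.
Qed.

End framed_exponential_maps.

Section exponential_immersions.
Context {R : realType} {n N : nat}.
Variables (xi : 'I_N -> 'rV[R]_n) (O : 'M[R]_(N + N)) (c : 'I_N -> R).
Hypothesis n_gt0 : (0 < n)%N.
Hypothesis O_orth : O *m O^T = 1%:M.

Let x := framed_exp xi O c (fun=> 0).

Lemma exp_mapE u : exp_map xi c u *m O = x u.
Proof.
rewrite /x /framed_exp /exp_map; congr (row_mx _ _ *m O); apply/rowP => k;
  by rewrite !mxE /phase mul0r ?subr0 ?add0r.
Qed.

Lemma first_fundamental_form_exp u : first_fundamental_form x u =
  (4 * pi ^+ 2) *: \sum_k c k ^+ 2 *: ((xi k)^T *m xi k).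
Proof.
apply/matrixP => i j; rewrite !mxE summxE !partial_framed_exp.
rewrite dotv_framed_exp// mulr_sumr; apply: eq_bigr => k _.
by rewrite !mxE big_ord1 !mxE; ring.
Qed.

(** Isometry becomes a tight frame condition on the weighted frequencies once the nonzero factor
    [4 pi^2] is cancelled. *)
Lemma first_fundamental_form_torus u :
  (\sum_k c k ^+ 2 *: ((xi k)^T *m xi k) = n%:R^-1%:M) <->
  (first_fundamental_form x u = torus_metric R n).
Proof.
rewrite first_fundamental_form_exp /torus_metric -scale_scalar_mx.
split=> [-> //|]; apply: scalerI; rewrite mulf_neq0 ?sqrf_eq0//.
by rewrite gt_eqF// pi_gt0.
Qed.

Lemma trace_tight_frame :
  \sum_k c k ^+ 2 *: ((xi k)^T *m xi k) = n%:R^-1%:M ->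
  \sum_k c k ^+ 2 * dotv (xi k) (xi k) = 1.
Proof.
move=> /(congr1 mxtrace); rewrite mxtrace_scalar -[_ *+ n]mulr_natr.
rewrite mulVf; last first.
  by rewrite pnatr_eq0 -lt0n.
move=> <-; rewrite raddf_sum/=; apply: eq_bigr => k _.
by rewrite mxtraceZ mxtrace_mulC trace_mx11.
Qed.

(** The Laplacian of [x]: the inverse metric contributes [n / (4 pi^2)], the second derivatives
    [- 4 pi^2 |xi k|^2]. *)
Let lap :=
  framed_exp xi O (fun k => - (n%:R * dotv (xi k) (xi k) * c k)) (fun=> 0).

Lemma mean_curvature_exp u (nu : 'rV[R]_(N + N)) :
  first_fundamental_form x u = torus_metric R n ->
  mean_curvature x u nu = n%:R^-1 * dotv (lap u) nu.
Proof.
move=> fffE; rewrite /mean_curvature fffE; congr (_ * _).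
rewrite /torus_metric invmx_scalar mul_scalar_mx mxtraceZ /mxtrace mulr_sumr.
under eq_bigr => i _ do rewrite mxE !partial_framed_exp -dotvZl.
rewrite -dotv_suml; congr dotv.
rewrite /lap /framed_exp -?mulmx_suml.
under eq_bigr => i _ do rewrite scalemxAl.
rewrite -mulmx_suml; congr (_ *m O); apply/rowP => j; rewrite summxE.
have pi0 : (pi : R) != 0 by rewrite gt_eqF// pi_gt0.
have n0 : (n%:R : R) != 0 by rewrite pnatr_eq0 -lt0n.
have [k ->|k ->] := split_ordP j.
- rewrite row_mxEl !mxE dotvE !mulr_sumr.
  rewrite mul0r subr0 mulr_suml -sumrN mulr_suml; apply: eq_bigr => i _.
  rewrite mxE row_mxEl !mxE; move: pi pi0 => w w0; field; exact/andP.
- rewrite row_mxEr !mxE dotvE !mulr_sumr.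
  rewrite mul0r add0r mulr_suml -sumrN mulr_suml; apply: eq_bigr => i _.
  rewrite mxE row_mxEr !mxE; move: pi pi0 => w w0; field; exact/andP.
Qed.

Hypothesis tight : \sum_k c k ^+ 2 *: ((xi k)^T *m xi k) = n%:R^-1%:M.
Hypothesis c_unit : \sum_k c k ^+ 2 = 1.

(* [nu = lap + n x] is normal to [x] inside the sphere, so minimality makes it
   orthogonal to [lap], hence to itself. *)
Lemma minimal_exp_unit : minimal x ->
  forall k, c k != 0 -> dotv (xi k) (xi k) = 1.
Proof.
move=> xmin k ck0; pose l k := dotv (xi k) (xi k).
pose nu := framed_exp xi O (fun k => n%:R * (1 - l k) * c k) (fun=> 0).
have n0 : (n%:R : R) != 0 by rewrite pnatr_eq0 -lt0n.
have fff := (first_fundamental_form_torus 0).1 tight.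
(* Orthogonality to [x] compares [c_unit] with the trace of [tight]; a derivative of [x] is a real
   multiple of a quarter turn of [nu] or of zero in each coordinate product, so those products
   vanish. *)
have nuP : sphere_normal x 0 (nu 0).
  split.
    rewrite dotv_framed_exp//.
    transitivity (n%:R * (\sum_k c k ^+ 2 - \sum_k c k ^+ 2 * l k)).
      by rewrite -sumrB mulr_sumr; apply: eq_bigr => j _; ring.
    by rewrite c_unit trace_tight_frame// subrr mulr0.
  move=> i; rewrite partial_framed_exp dotv_framed_exp// big1// => j _; ring.
have /eqP := xmin 0 (nu 0) nuP; rewrite mean_curvature_exp// mulf_eq0 invr_eq0.
rewrite (negbTE n0)/= dotv_framed_exp// => /eqP lap0.
have nu0 : \sum_k (n%:R * (1 - l k) * c k) ^+ 2 = 0.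
  rewrite -[RHS]addr0 -[X in _ = X + _]lap0 -[X in _ = _ + X](mulr0 n%:R).
  rewrite -[X in _ = _ + _ * X]nuP.1 dotv_framed_exp// mulr_sumr -big_split/=.
  by apply: eq_bigr => j _; rewrite /l; ring.
move/eqP : nu0; rewrite psumr_eq0 => [|j _]; last exact: sqr_ge0.
move=> /allP/(_ k (mem_index_enum _)).
rewrite /= sqrf_eq0 !mulf_eq0 (negbTE n0) (negbTE ck0) orbF/= subr_eq0.
by move=> /eqP/esym.
Qed.

(** For unit frequencies the Laplacian is [- n x], which is orthogonal to every normal inside the
    sphere: Takahashi's criterion. *)
Lemma unit_exp_minimal : (forall k, dotv (xi k) (xi k) = 1) -> minimal x.
Proof.
move=> l1 u nu [xnu _].
rewrite mean_curvature_exp; last exact/first_fundamental_form_torus.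
have -> : lap u = - n%:R *: x u.
  rewrite /lap /x /framed_exp scalemxAl; congr (_ *m O).
  rewrite scale_row_mx; congr row_mx; apply/rowP => k;
    rewrite !mxE l1; ring.
by rewrite dotvC dotvZr dotvC xnu !mulr0.
Qed.

Lemma isometric_immersion_exp (L : set 'rV[R]_n) :
  (forall k, dual_lattice L (xi k)) ->
  isometric_immersion L (torus_metric R n) x.
Proof.
move=> xiL; have fff u := (first_fundamental_form_torus u).1 tight.
split => //.
- exact: smooth_framed_exp.
- exact: periodic_framed_exp.
- move=> u; apply/enorm_eq1; rewrite dotv_framed_exp// -c_unit.
  by apply: eq_bigr => k _; ring.
(* The Jacobian times its transpose is the metric, whose invertibility forces full row rank. *)
- move=> u; have J : jacobian x u *m (jacobian x u)^T = torus_metric R n.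
    rewrite -(fff u); apply/matrixP => i j; rewrite [RHS]mxE /partial.
    rewrite !deriveEjacobian; [|exact: differentiable_framed_exp..].
    rewrite dotvE -!rowE mxE; apply: eq_bigr => k _.
    by rewrite ![row _ _ _ _]mxE [_^T _ _]mxE.
  have Ju : torus_metric R n \in unitmx.
    rewrite /torus_metric unitmxE det_scalar unitrX// unitfE.
    have pi0 : (pi : R) != 0 by rewrite gt_eqF// pi_gt0.
    by rewrite !mulf_neq0// ?expf_neq0// ?invr_eq0 pnatr_eq0 -lt0n.
  rewrite -row_leq_rank -{1}(mxrank_unit Ju) -J; exact: mxrankM_maxl.
Qed.

End exponential_immersions.

(** * Eigenfunctions of the torus *)

(** The coordinates of the [f i] in a basis form a square matrix with trivial left kernel; its
    inverse expresses [g] through the [f i]. *)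
Lemma has_dim_span (R : realType) (T : Type) (E : set (T -> R)) (d : nat)
    (f : 'I_d -> T -> R) (g : T -> R) :
  has_dim E d -> (forall i, E (f i)) ->
  (forall w : 'I_d -> R, (forall u, \sum_i w i * f i u = 0) ->
     forall i, w i = 0) ->
  E g -> exists t : 'I_d -> R, forall u, g u = \sum_i t i * f i u.
Proof.
move=> [b [_ _ bspan]] Ef find Eg.
have [M fM] : {M : 'I_d -> 'I_d -> R & forall i u,
    f i u = \sum_k M i k * b k u}.
  apply: (@choice _ _ (fun i t => forall u, f i u = \sum_k t k * b k u)).
  by move=> i; exact: bspan.
pose A : 'M[R]_d := \matrix_(i, k) M i k.
have comb (w : 'rV[R]_d) u :
    \sum_i w 0 i * f i u = \sum_k (w *m A) 0 k * b k u.
  under eq_bigr => i _ do rewrite fM mulr_sumr.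
  rewrite exchange_big/=; apply: eq_bigr => k _.
  rewrite mxE mulr_suml; apply: eq_bigr => i _; by rewrite mxE mulrA.
have Au : A \in unitmx.
  rewrite -row_free_unit; apply/inj_row_free => w wA.
  apply/rowP => i; rewrite mxE; apply: (find (fun i => w 0 i)) => u.
  by rewrite comb wA big1// => k _; rewrite mxE mul0r.
have [t gt] := bspan g Eg.
exists (fun i => (\row_k t k *m invmx A) 0 i) => u.
by rewrite comb mulmxKV// gt; apply: eq_bigr => k _; rewrite mxE.
Qed.

(* The difference operator [f |-> f (u + v) + f (u - v) - 2 cos (phase xi v) f]
   multiplies a wave of frequency [eta] by
   [2 (cos (phase eta v) - cos (phase xi v))], so it kills frequency [xi]. *)
Lemma trig_separation (R : realType) (n N : nat) (xi v : 'I_N -> 'rV[R]_n)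
    (a b : 'I_N -> R^o) (eta : 'rV[R]_n) (A : R) :
  (forall k, cos (phase eta (v k)) != cos (phase (xi k) (v k))) ->
  (forall u, A * cos (phase eta u) = trig xi a b u) -> A = 0.
Proof.
elim: N xi v a b A => [|N IHN] xi v a b A sep eqA.
  have := eqA 0; rewrite /trig big_ord0 /phase -[0](scale0r (0 : 'rV[R]_n)).
  by rewrite dotvZr mul0r mulr0 cos0 mulr1.
pose w := v ord0; pose cw := cos (phase (xi ord0) w).
pose r (zeta : 'rV[R]_n) := 2 * (cos (phase zeta w) - cw).
have wave (zeta u : 'rV[R]_n) (al be : R) :
    let f u := cos (phase zeta u) * al + sin (phase zeta u) * be in
    f (u + w) + f (u - w) - 2 * cw * f u = r zeta * f u.
  rewrite /= !phaseD phaseN !cosD !sinD cosN sinN /r; ring.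
have : A * r eta = 0.
  apply: (IHN (fun k => xi (lift ord0 k)) (fun k => v (lift ord0 k))
    (fun k => r (xi (lift ord0 k)) * a (lift ord0 k))
    (fun k => r (xi (lift ord0 k)) * b (lift ord0 k))) => [k|u].
    exact: sep.
  have := wave eta u A 0; rewrite /= !mulr0 !addr0 ![_ * A]mulrC !eqA.
  move=> tE; rewrite mulrAC eqA [_ * r eta]mulrC -tE.
  rewrite /trig -big_split/= mulr_sumr -sumrB big_ord_recl/=.
  have r0 : r (xi ord0) = 0 by rewrite /r subrr mulr0.
  rewrite (wave (xi ord0) u (a ord0) (b ord0)) r0 mul0r add0r.
  apply: eq_bigr => k _.
  rewrite (wave (xi (lift ord0 k)) u (a (lift ord0 k)) (b (lift ord0 k))).
  by rewrite /= /GRing.scale/=; ring.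
move=> /eqP; rewrite mulf_eq0 => /orP[/eqP//|].
rewrite /r mulf_eq0 pnatr_eq0/= subr_eq0.
by rewrite (negbTE (sep ord0)).
Qed.

(** At half of [xi] the phase of [xi] is [pi], that of [eta] is [pi <eta, xi>] with
    [|<eta, xi>| < 1] by strict Cauchy-Schwarz, and the cosine is injective on [[0, pi]]. *)
Lemma cos_phase_separation (R : realType) (n : nat) (xi eta : 'rV[R]_n) :
  dotv xi xi = 1 -> dotv eta eta = 1 -> eta != xi -> eta != - xi ->
  cos (phase eta (2^-1 *: xi)) != cos (phase xi (2^-1 *: xi)).
Proof.
move=> xi1 eta1 neq neqN.
have phE (z : 'rV[R]_n) : phase z (2^-1 *: xi) = pi * dotv z xi.
  by rewrite /phase dotvZr; field.
rewrite !phE xi1 mulr1.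
(* For [e = 1] and [e = -1], the squared distance from [eta] to [e xi] is [2 (1 - e <eta, xi>)]. *)
have dist (e : R) : e ^+ 2 = 1 -> eta != e *: xi -> 0 < 1 - e * dotv eta xi.
  move=> e2 ne; rewrite -(pmulr_rgt0 _ (ltr0Sn R 1)).
  have -> : 2 * (1 - e * dotv eta xi) = dotv (eta - e *: xi) (eta - e *: xi).
    rewrite -(scaleNr e xi) !(dotvDl, dotvDr, dotvZl, dotvZr) xi1 eta1.
    rewrite [dotv xi eta]dotvC.
    by transitivity (1 + e ^+ 2 - 2 * (e * dotv eta xi)); [rewrite e2|]; ring.
  rewrite lt_def dotv_ge0 andbT; apply: contraNneq ne => /dotv_eq0/eqP.
  by rewrite subr_eq0.
have := dist 1 (expr1n _ _); rewrite scale1r => /(_ neq).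
have := dist (-1); rewrite sqrrN expr1n => /(_ erefl).
rewrite scaleN1r => /(_ neqN).
set d := dotv eta xi => dN dP.
have pi_gt0 : 0 < (pi : R) := pi_gt0 R.
have -> : cos (pi * d) = cos (pi * `|d|).
  by case: (ger0P d) => // _; rewrite mulrN cosN.
have d1 : `|d| < 1 by rewrite ltr_norml; lra.
apply/eqP => /cos_inj; rewrite !in_itv/= lexx pi_ge0 mulr_ge0 ?pi_ge0//.
rewrite ger_pMr// ltW// => /(_ isT isT) /eqP.
by rewrite lt_eqF// gtr_pMr.
Qed.

Lemma laplacian_trig (R : realType) (n N : nat) (xi : 'I_N -> 'rV[R]_n)
    (a b : 'I_N -> R^o) (u : 'rV[R]_n) :
  (forall k, dotv (xi k) (xi k) = 1) ->
  laplacian (torus_metric R n) (trig xi a b) u = - n%:R * trig xi a b u.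
Proof.
move=> xi1; rewrite /laplacian /torus_metric invmx_scalar.
under eq_bigr => i _.
  rewrite (bigD1 i)//= big1 ?addr0; last first.
    by move=> j ji; rewrite mxE eq_sym (negbTE ji) mulr0n mul0r.
  rewrite mxE eqxx mulr1n !partial_trig /trig mulr_sumr.
  over.
rewrite exchange_big/= /trig mulr_sumr; apply: eq_bigr => k _.
have -> : - n%:R = - (n%:R * dotv (xi k) (xi k)) by rewrite xi1 mulr1.
rewrite dotvE mulr_sumr -sumrN mulr_suml.
apply: eq_bigr => i _; rewrite /GRing.scale/=.
have pi0 : (pi : R) != 0 by rewrite gt_eqF// pi_gt0.
move: pi pi0 => w w0.
have n0 : (n%:R : R) != 0 by rewrite pnatr_eq0 -lt0n (leq_trans _ (ltn_ord i)).
field; exact/andP.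
Qed.

Lemma trig_eigenspace (R : realType) (n N : nat) (L : set 'rV[R]_n)
    (xi : 'I_N -> 'rV[R]_n) (a b : 'I_N -> R^o) :
  (forall k, dotv (xi k) (xi k) = 1) -> (forall k, dual_lattice L (xi k)) ->
  torus_eigenspace L (torus_metric R n) n%:R (trig xi a b).
Proof.
move=> xi1 xiL; split; [exact: smooth_trig|exact: periodic_trig|move=> u].
by rewrite laplacian_trig// mulNr opprK.
Qed.

Lemma linearly_full_ker (R : realType) (n m : nat)
    (x : 'rV[R]_n -> 'rV[R]_m) (w : 'cV[R]_m) :
  linearly_full x -> (forall u, x u *m w = 0) -> w = 0.
Proof.
move=> xfull xw; pose f : 'Hom('rV[R]_m, 'M[R]_(1, 1)) := linfun (mulmxr w).
have /xfull kerT : forall u, x u \in lker f.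
  by move=> u; rewrite memv_ker lfunE/= xw.
apply/matrixP => i j; have : delta_mx 0 i \in lker f by rewrite kerT memvf.
rewrite memv_ker lfunE/= -rowE => /eqP/matrixP/(_ 0 j).
by rewrite !mxE.
Qed.

(** * From full minimal immersions to critical points *)

Lemma wave_eigenspace (R : realType) (n : nat) (L : set 'rV[R]_n)
    (xi : 'rV[R]_n) :
  dotv xi xi = 1 -> dual_lattice L xi ->
  torus_eigenspace L (torus_metric R n) n%:R (fun u => cos (phase xi u)) /\
  torus_eigenspace L (torus_metric R n) n%:R (fun u => sin (phase xi u)).
Proof.
move=> xi1 xiL.
have E (a b : R) := @trig_eigenspace R n 1 L (fun=> xi) (fun=> a) (fun=> b)
  (fun=> xi1) (fun=> xiL).
split; [have := E 1 0|have := E 0 1]; congr (torus_eigenspace _ _ _ _);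
  by apply/funext => u; rewrite /trig big_ord1 /GRing.scale/=; ring.
Qed.

Section full_minimal_exponential.
Context {R : realType} {n N : nat}.
Variables (xi : 'I_N -> 'rV[R]_n) (O : 'M[R]_(N + N)) (c : 'I_N -> R).
Hypothesis O_orth : O *m O^T = 1%:M.
Hypothesis full : linearly_full (framed_exp xi O c (fun=> 0)).

(** A relation between the weighted waves is a linear form vanishing on the image, once the frame
    [O] is undone by its transpose; fullness kills it. *)
Lemma full_exp_independent (a b : 'I_N -> R) :
  (forall u, \sum_k (a k * (c k * cos (phase (xi k) u)) +
                     b k * (c k * sin (phase (xi k) u))) = 0) ->
  forall k, a k = 0 /\ b k = 0.
Proof.
move=> ab0 k; pose w := col_mx (\col_k a k) (\col_k b k).
have : O^T *m w = 0.
  apply: linearly_full_ker full _ => u.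
  rewrite /framed_exp mulmxA -[_ *m O *m _]mulmxA O_orth mulmx1 mul_row_col.
  apply/matrixP => i j; rewrite !ord1 mxE [X in X + _]mxE [X in _ + X]mxE.
  rewrite -big_split/= mxE -[RHS](ab0 u); apply: eq_bigr => l _.
  by rewrite !mxE; ring.
move=> /(congr1 (mulmx O)); rewrite mulmxA O_orth mul1mx mulmx0 => w0.
have w00 i : w i 0 = 0 by rewrite w0 mxE.
by have := w00 (lshift N k); have := w00 (rshift N k);
  rewrite col_mxEu col_mxEd !mxE.
Qed.

Lemma full_exp_neq0 k : c k != 0.
Proof.
apply/eqP => ck0.
have [] := @full_exp_independent
  (fun l => if l == k then 1 else 0) (fun=> 0) _ k.
  move=> u; rewrite big1// => l _; have [->|_] := eqVneq l k.
    by rewrite ck0; ring.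
  by ring.
by rewrite eqxx => /eqP; rewrite oner_eq0.
Qed.

(** The [N + N] waves are independent, so by dimension they span the eigenspace. The wave of [eta]
    is then a combination of them, which separation forbids unless [eta] is some [xi k] up to
    sign. *)
Lemma full_unit_frequencies (L : set 'rV[R]_n) (eta : 'rV[R]_n) :
  has_dim (torus_eigenspace L (torus_metric R n) n%:R) (N + N) ->
  (forall k, dual_lattice L (xi k)) -> (forall k, dotv (xi k) (xi k) = 1) ->
  dual_lattice L eta -> dotv eta eta = 1 ->
  exists k, eta = xi k \/ eta = - xi k.
Proof.
move=> dimE xiL xi1 etaL eta1; apply: contrapT => neta.
pose f (i : 'I_(N + N)) (u : 'rV[R]_n) : R := match fintype.split i with
  | inl k => cos (phase (xi k) u) | inr k => sin (phase (xi k) u) end.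
have sum_f (w : 'I_(N + N) -> R) u : \sum_i w i * f i u =
    trig xi (fun k => w (lshift N k) : R^o) (fun k => w (rshift N k) : R^o) u.
  rewrite big_split_ord/= /trig -big_split/=; apply: eq_bigr => k _.
  by rewrite /f (unsplitK (inl _)) (unsplitK (inr _)) !(mulrC (w _)).
have [|||t tP] := has_dim_span (f := f) (g := fun u => cos (phase eta u)) dimE.
- move=> i; have [k ik|k ik] := split_ordP i.
    have [+ _] := wave_eigenspace (xi1 k) (xiL k).
    congr (torus_eigenspace _ _ _ _).
    by apply/funext => u; rewrite /f ik (unsplitK (inl _)).
  have [_ +] := wave_eigenspace (xi1 k) (xiL k).
  congr (torus_eigenspace _ _ _ _).
  by apply/funext => u; rewrite /f ik (unsplitK (inr _)).
- move=> w w0.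
  have wE k : w (lshift N k) = 0 /\ w (rshift N k) = 0.
    (* Dividing by [c k] compensates for the amplitudes present in the independence statement. *)
    have [|/eqP + /eqP] := @full_exp_independent
      (fun k => w (lshift N k) / c k) (fun k => w (rshift N k) / c k) _ k.
      move=> u; rewrite -[RHS](w0 u) sum_f; apply: eq_bigr => l _.
      by rewrite /GRing.scale/= !mulrA !divfK ?full_exp_neq0// !(mulrC (w _)).
    rewrite !mulf_eq0 !invr_eq0 (negbTE (full_exp_neq0 k)) !orbF.
    by move=> /eqP ? /eqP.
  by move=> i; have [k ->|k ->] := split_ordP i; have [] := wE k.
- by have [] := wave_eigenspace eta1 etaL.
suff /eqP : (1 : R) = 0 by rewrite oner_eq0.
apply: (@trig_separation R n N xi (fun k => 2^-1 *: xi k)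
  (fun k => t (lshift N k)) (fun k => t (rshift N k)) eta) => [k|u].
- apply: cos_phase_separation => //; apply/eqP => e; apply: neta; exists k;
    by [left|right].
- by rewrite mul1r tP sum_f.
Qed.

End full_minimal_exponential.

(** For [A = P^-1], this makes the derivative of the determinant at [P] vanish along differences of
    points of the affine hull. *)
Lemma mxtrace_const_affine_hull (R : realType) (n : nat) (A : 'M[R]_n)
    (S : set 'M[R]_n) (r : R) :
  (forall p, S p -> \tr (A *m p) = r) ->
  forall p, affine_hull S p -> \tr (A *m p) = r.
Proof.
move=> AS p [k [t [s [t1 Ss ->]]]]; rewrite mulmx_sumr raddf_sum/=.
under eq_bigr => i _ do rewrite -scalemxAr mxtraceZ AS//.
by rewrite -mulr_suml t1 mul1r.
Qed.

Lemma zrowN (R : realType) (n : nat) (a : 'rV[int]_n) :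
  zrow R (- a) = - zrow R a.
Proof. exact: map_mxN. Qed.

Lemma outerN (R : realType) (n : nat) (v : 'rV[R]_n) :
  (- v)^T *m - v = v^T *m v.
Proof. by rewrite mulmxN linearN/= mulNmx opprK. Qed.

Lemma gram_unit (R : realType) (n : nat) (D : 'M[R]_n) :
  (gram D \in unitmx) = (D \in unitmx).
Proof. by rewrite /gram unitmx_mul unitmx_tr andbb. Qed.

Lemma invmx_gram (R : realType) (n : nat) (D : 'M[R]_n) :
  D \in unitmx -> invmx (gram D) = (invmx D)^T *m invmx D.
Proof.
move=> Du; have Gu : gram D \in unitmx by rewrite gram_unit.
rewrite -[RHS](mulKmx Gu) /gram trmx_inv -!mulmxA.
by rewrite [D^T *m _]mulmxA mulmxV ?unitmx_tr// mul1mx mulmxV// mulmx1.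
Qed.

Lemma full_minimal_critical (R : realType) (n N : nat) (L : set 'rV[R]_n)
    (x : 'rV[R]_n -> 'rV[R]_(N + N)) (D : 'M[R]_n) (Y : set 'rV[int]_n) :
  (0 < n)%N ->
  has_dim (torus_eigenspace L (torus_metric R n) n%:R) (N + N) ->
  isometric_immersion L (torus_metric R n) x ->
  homogeneous L x ->
  lattice_basis D (dual_lattice L) ->
  unit_coordinates D Y ->
  minimal x ->
  linearly_full x ->
  relative_interior (C_ R Y) (n%:R^-1 *: invmx (gram D)) /\
  critical_point (fun M : 'M[R]_n => \det M) (C_ R Y)
    (n%:R^-1 *: invmx (gram D)).
Proof.
move=> n_gt0 dimE iso [xi [c [U [xiL _ U_orth xE]]]] [Du DL].
move=> [Y1 Y2] xmin full.
have {xE} xE : x = framed_exp xi U c (fun=> 0).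
  by apply/funext => u; rewrite xE exp_mapE.
subst x.
have tight : \sum_k c k ^+ 2 *: ((xi k)^T *m xi k) = n%:R^-1%:M.
  apply: (first_fundamental_form_torus xi c U_orth 0).2.
  exact: immersion_isometric iso 0.
have c_unit : \sum_k c k ^+ 2 = 1.
  have /enorm_eq1 <- := immersion_sphere iso 0.
  by rewrite dotv_framed_exp//; apply: eq_bigr => k _; ring.
have c_neq0 := full_exp_neq0 U_orth full.
have xi1 k : dotv (xi k) (xi k) = 1.
  exact: minimal_exp_unit n_gt0 U_orth tight c_unit xmin k (c_neq0 k).
have [z zP] : {z : 'I_N -> 'rV[int]_n & forall k, zrow R (z k) *m D = xi k}.
  apply: (@choice _ _ (fun k a => zrow R a *m D = xi k)) => k.
  by have := xiL k; rewrite DL => -[a _ aE]; exists a.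
pose s k := (zrow R (z k))^T *m zrow R (z k).
have n0 : (n%:R : R) != 0 by rewrite pnatr_eq0 -lt0n.
set P := n%:R^-1 *: invmx (gram D).
(* One inclusion is the exhaustion of the unit vectors, the other the choice of a vector in each
   pair; outer products ignore the sign. *)
have CE : C_ R Y = convex_hull (range s).
  congr convex_hull; apply/seteqP; split => [_ [a Ya <-]|_ [k _ <-]].
    have aL : dual_lattice L (zrow R a *m D) by rewrite DL; exists a.
    have /enorm_eq1 a1 := Y1 a Ya.
    have [k] := full_unit_frequencies U_orth full dimE xiL xi1 aL a1.
    rewrite -zP -mulNmx => aE; exists k => //; rewrite /s.
    case: aE => /(can_inj (mulmxK Du)) -> //.
    by rewrite outerN.
  have [|[Yz|Yz] _] := Y2 (z k); first by apply/enorm_eq1; rewrite zP.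
    by exists (z k).
  exists (- z k) => //.
  by rewrite zrowN outerN.
have PE : P = \sum_k c k ^+ 2 *: s k.
  (* The congruence by [D] turns each [s k] into [xi k^T xi k], so the sum becomes that of
     [tight]. *)
  have DPD : D^T *m (\sum_k c k ^+ 2 *: s k) *m D = n%:R^-1%:M.
    rewrite mulmx_sumr mulmx_suml -tight; apply: eq_bigr => k _.
    by rewrite -scalemxAr -scalemxAl -zP trmx_mul /s !mulmxA.
  have DTu : D^T \in unitmx by rewrite unitmx_tr.
  apply: (can_inj (mulKmx DTu)); apply: (can_inj (mulmxK Du)); rewrite DPD.
  rewrite /P invmx_gram// trmx_inv -scalemxAr -scalemxAl mulKVmx// mulVmx//.
  by rewrite scalemx1.
have Pu : P \in unitmx.
  by rewrite unitmxZ ?unitfE ?invr_eq0// unitmx_inv gram_unit.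
(* Since [P^-1 = n D D^T], the trace on a generator is [n |xi k|^2 = n]. *)
have trs p : affine_hull (C_ R Y) p -> \tr (invmx P *m p) = n%:R.
  rewrite CE => /affine_hull_convex_hull; apply: mxtrace_const_affine_hull.
  move=> _ [k _ <-].
  rewrite /P invmxZ ?unitmxZ ?unitfE ?invr_eq0 ?unitmx_inv ?gram_unit//.
  rewrite invmxK invrK.
  rewrite -scalemxAl mxtraceZ mulmxA mxtrace_mulC trace_mx11.
  rewrite -[RHS]mulr1 -(xi1 k).
  by rewrite -zP /dotv trmx_mul /gram !mulmxA.
split.
  rewrite CE PE; apply: relative_interior_pos => // k.
  by rewrite exprn_even_gt0//= c_neq0.
move=> q q' /trs qn /trs q'n.
apply: is_derive_eq (is_derive_det (q - q') n_gt0 Pu) _.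
by rewrite mulmxBr raddfB/= qn q'n subrr mulr0.
Qed.

(** * From critical points to minimal immersions *)

Lemma quad_outer (R : realType) (n : nat) (v a : 'rV[R]_n) :
  (v *m (a^T *m a) *m v^T) 0 0 = dotv v a ^+ 2.
Proof.
rewrite mulmxA -mulmxA [v *m _]mx11_scalar mul_scalar_mx mxE -/(dotv v a).
by rewrite -/(dotv a v) dotvC.
Qed.

Lemma C_psd (R : realType) (n : nat) (X : set 'rV[int]_n) (P : 'M[R]_n) :
  C_ R X P -> P^T = P /\ forall v : 'rV[R]_n, 0 <= (v *m P *m v^T) 0 0.
Proof.
move=> [k [t [s [t_ge0 _ Xs ->]]]]; split.
  rewrite linear_sum/=; apply: eq_bigr => i _.
  by have [a _ <-] := Xs i; rewrite linearZ/= trmx_mul trmxK.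
move=> v; rewrite mulmx_sumr mulmx_suml summxE; apply: sumr_ge0 => i _.
have [a _ <-] := Xs i; rewrite -scalemxAr -scalemxAl mxE quad_outer.
by rewrite mulr_ge0 ?sqr_ge0.
Qed.

(* Moving from a definite point [Q] through [P] slightly beyond [P] stays in
   the hull, so [P] is a positive multiple of a semidefinite plus a definite
   matrix. *)
Lemma relative_interior_posdef (R : realType) (n : nat) (X : set 'rV[int]_n)
    (P : 'M[R]_n) :
  C_ R X `&` posdef R n !=set0 -> relative_interior (C_ R X) P -> posdef R n P.
Proof.
move=> [Q [QC [_ Qpos]]] [PC [e e_gt0 eP]].
split; first by have [] := C_psd PC.
move=> v v0; have d_gt0 : 0 < `|P - Q| + 1 by rewrite ltr_wpDl.
(* This keeps the norm of [r (P - Q)] below [e]; the [+ 1] covers the case [P = Q]. *)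
pose r := e / (`|P - Q| + 1).
have r_gt0 : 0 < r by rewrite divr_gt0.
have [|_ /(_ v)] := C_psd (eP (P + r *: (P - Q)) _).
  split; last exact: affine_hull_line.
  rewrite -ball_normE/= opprD addNKr normrN normrZ gtr0_norm//.
  by rewrite mulrAC ltr_pdivrMr// ltr_pM2l// ltrDl.
have := Qpos v v0.
rewrite mulmxDr mulmxDl -scalemxAr -scalemxAl mulmxBr mulmxBl.
move: (v *m P *m v^T) (v *m Q *m v^T) => p q; rewrite !mxE => q_gt0 pq.
rewrite -(pmulr_rgt0 _ (addr_gt0 ltr01 r_gt0)).
apply: lt_le_trans (mulr_gt0 r_gt0 q_gt0) _.
by rewrite -subr_ge0 (_ : _ - _ = p 0 0 + r * (p 0 0 - q 0 0))//; ring.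
Qed.

Lemma lattice_existence (R : realType) (n : nat) (P : 'M[R]_n) :
  posdef R n P -> exists (L : set 'rV[R]_n) (B : 'M[R]_n),
    lattice_basis B L /\ gram B = P.
Proof.
move=> /cholesky[B Bu BP].
by exists [set zrow R a *m B | a in [set: 'rV[int]_n]], B.
Qed.

(** As [det P] is nonzero, criticality makes [tr (P^-1 q)] constant for [q] in the affine hull; at
    [q = P] its value is [n]. *)
Lemma critical_quad (R : realType) (n : nat) (X : set 'rV[int]_n)
    (P : 'M[R]_n) (a : 'rV[int]_n) :
  (0 < n)%N -> P \in unitmx -> C_ R X P ->
  critical_point (fun M : 'M[R]_n => \det M) (C_ R X) P -> X a ->
  (zrow R a *m invmx P *m (zrow R a)^T) 0 0 = n%:R.
Proof.
move=> n_gt0 Pu PC crit Xa.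
have gen p : [set (zrow R a)^T *m zrow R a | a in X] p ->
    affine_hull (C_ R X) p.
  by move=> Xp; exact/affine_hull_sub/convex_hull_sub.
set p := (zrow R a)^T *m zrow R a.
have pX : affine_hull (C_ R X) p by apply: gen; exists a.
have trE q : affine_hull (C_ R X) q -> \tr (invmx P *m q) = \tr (invmx P *m p).
  move=> qX; have [_ d0] := crit q p qX pX.
  have [_] := is_derive_det (q - p) n_gt0 Pu; rewrite d0 => /esym/eqP.
  rewrite mulf_eq0 mulmxBr raddfB/= subr_eq0.
  by move: Pu; rewrite unitmxE unitfE => /negbTE ->/= /eqP.
rewrite -trace_mx11 -mxtrace_mulC mulmxA mxtrace_mulC -/p -(trE P).
  by rewrite mulVmx// mxtrace1.
exact: affine_hull_sub.
Qed.

(** The rows of the inverse transpose of [B] are the dual basis, so the pairing is that of integer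
    coordinates. *)
Lemma dual_lattice_zrow (R : realType) (n : nat) (L : set 'rV[R]_n)
    (B : 'M[R]_n) (a : 'rV[int]_n) :
  lattice_basis B L -> dual_lattice L (zrow R a *m invmx B^T).
Proof.
move=> [Bu ->] _ [b _ <-].
rewrite /dotv trmx_mul mulmxA mulmxKV ?unitmx_tr// -/(dotv _ _) dotvE.
by apply: rpred_sum => i _; rewrite !mxE rpredM// intr_int.
Qed.

Lemma critical_minimal_immersion (R : realType) (n : nat)
    (X : set 'rV[int]_n) (P : 'M[R]_n) (L : set 'rV[R]_n) (B : 'M[R]_n) :
  (0 < n)%N -> C_ R X P ->
  critical_point (fun M : 'M[R]_n => \det M) (C_ R X) P ->
  lattice_basis B L -> gram B = n%:R *: P ->
  exists (N : nat) (x : 'rV[R]_n -> 'rV[R]_(N + N)),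
    isometric_immersion L (torus_metric R n) x /\ minimal x.
Proof.
move=> n_gt0 PC crit BL GE; have [Bu _] := BL.
have n0 : (n%:R : R) != 0 by rewrite pnatr_eq0 -lt0n.
have PE : P = n%:R^-1 *: gram B by rewrite GE scalerA mulVf// scale1r.
have Pu : P \in unitmx.
  by rewrite PE unitmxZ ?gram_unit// unitfE invr_eq0.
have [k [t [s [t_ge0 t1 Xs PS]]]] := PC.
have [a aP] : {a : 'I_k -> 'rV[int]_n & forall i,
    X (a i) /\ (zrow R (a i))^T *m zrow R (a i) = s i}.
  apply: (@choice _ _ (fun i b => X b /\ (zrow R b)^T *m zrow R b = s i)) => i.
  by have [b Xb bE] := Xs i; exists b.
(* Each generator in the combination giving [P] yields a dual lattice vector, with the root of its
   weight as amplitude. *)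
pose xi i := zrow R (a i) *m invmx B^T.
pose c i := Num.sqrt (t i).
have c2 i : c i ^+ 2 = t i by rewrite sqr_sqrtr.
have c_unit : \sum_i c i ^+ 2 = 1 by rewrite -t1; apply: eq_bigr.
(* The form of [P^-1] at [a i] equals [n |xi i|^2], and criticality makes it [n]. *)
have xi1 i : dotv (xi i) (xi i) = 1.
  have := critical_quad n_gt0 Pu PC crit (aP i).1.
  rewrite PE invmxZ ?unitmxZ ?gram_unit// ?unitfE ?invr_eq0// invrK.
  rewrite invmx_gram// -scalemxAr -scalemxAl mxE -[RHS]mulr1 => /(mulfI n0) <-.
  by rewrite /dotv /xi trmx_mul -trmx_inv trmxK !mulmxA.
have tight : \sum_i c i ^+ 2 *: ((xi i)^T *m xi i) = n%:R^-1%:M.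
  (* Stripping [B] and [B^T] from [n P = B B^T] leaves the identity, while termwise it turns the
     generators into [xi i^T xi i]. *)
  transitivity (invmx B *m P *m invmx B^T).
    rewrite PS mulmx_sumr mulmx_suml; apply: eq_bigr => i _.
    rewrite c2 -scalemxAr -scalemxAl -(aP i).2 /xi trmx_mul -trmx_inv trmxK.
    by rewrite !mulmxA.
  rewrite PE /gram -scalemxAr -scalemxAl mulKmx// mulmxV ?unitmx_tr//.
  by rewrite scalemx1.
have O1 : (1%:M : 'M[R]_(k + k)) *m 1%:M^T = 1%:M by rewrite trmx1 mulmx1.
exists k, (framed_exp xi 1%:M c (fun=> 0)); split.
- by apply: isometric_immersion_exp => // i; exact: dual_lattice_zrow.
- exact: unit_exp_minimal.
Qed.

Theorem theorem3p6 (R : realType) (n : nat) (n_gt0 : (0 < n)%N) :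
  (forall (N : nat) (L : set 'rV[R]_n) (x : 'rV[R]_n -> 'rV[R]_(N + N))
      (D : 'M[R]_n) (Y : set 'rV[int]_n),
    is_lattice L ->
    has_dim (torus_eigenspace L (torus_metric R n) n%:R) (N + N) ->
    isometric_immersion L (torus_metric R n) x ->
    homogeneous L x ->
    lattice_basis D (dual_lattice L) ->
    unit_coordinates D Y ->
    minimal x ->
    linearly_full x ->
    relative_interior (C_ R Y) (n%:R^-1 *: invmx (gram D)) /\
    critical_point (fun M : 'M[R]_n => \det M) (C_ R Y)
      (n%:R^-1 *: invmx (gram D)))
  /\
  (forall (X : set 'rV[int]_n) (P : 'M[R]_n),
    finite_set X ->
    C_ R X `&` posdef R n !=set0 ->
    relative_interior (C_ R X) P ->
    critical_point (fun M : 'M[R]_n => \det M) (C_ R X) P ->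
    (exists (L : set 'rV[R]_n) (B : 'M[R]_n),
      lattice_basis B L /\ gram B = n%:R *: P) /\
    (forall (L : set 'rV[R]_n) (B : 'M[R]_n),
      lattice_basis B L -> gram B = n%:R *: P ->
      exists (N : nat) (x : 'rV[R]_n -> 'rV[R]_(N + N)),
        isometric_immersion L (torus_metric R n) x /\ minimal x)).
Proof.
split=> [N L x D Y _|X P _ CX Pint crit]; first exact: full_minimal_critical.
have [PC _] := Pint; split; last first.
  by move=> L B; exact: critical_minimal_immersion crit.
(* [P] is definite as a relative interior point, so Cholesky factorisation of [n P] supplies a
   lattice basis. *)
apply: lattice_existence.
have [Psym Ppos] := relative_interior_posdef CX Pint.
split=> [|v v0]; first by rewrite linearZ/= Psym.
by rewrite -scalemxAr -scalemxAl mxE mulr_gt0 ?ltr0n ?Ppos.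
Qed.
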